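(* Let $G$ be a finite group and $\Gamma\subset G$ a union of non-trivial conjugacy classes such that $u_\Gamma$ generates $G$. Then there exists an integer $m=m(G)$ such that for any $\nu_0\ge m\,\nu(u_\Gamma)$ with $\nu_0\in\nu(\coprod_d\Gamma^d)$, $$\#\{[v]_\approx\mid \nu(v)=\nu_0,\ \langle v\rangle=G\}=\#\big(H_{2,\Gamma}(G)\times[G,G]\big).$$
   Context: A Hurwitz vector (of genus $0$) for $G$ is an element $v=(v_1,\dots,v_d)$ of $\coprod_{d\ge0}G^d$. The braid group $\mathrm{Br}_d$ acts on $G^d$ by the Hurwitz action, in which the standard generators act by $(\dots,v_i,v_{i+1},\dots)\mapsto(\dots,v_{i+1},v_{i+1}^{-1}v_iv_{i+1},\dots)$. Two Hurwitz vectors are braid equivalent, $v\approx w$, if they lie in the same braid group orbit; $[v]_\approx$ is the class of $v$. Put $\langle v\rangle=\langle v_1,\dots,v_d\rangle\subset G$; $v$ generates $G$ if $\langle v\rangle=G$. The Nielsen map $\nu:\coprod_d G^d\to\bigoplus_i\mathbb Z\,\mathcal C_i$ (sum over the conjugacy classes $\mathcal C_i$ of $G$) is $\nu(v)=\sum_i\nu_i\mathcal C_i$ with $\nu_i=\#\{j\mid v_j\in\mathcal C_i\}$; the target is partially ordered coefficientwise. With $g_1,\dots,g_r$ an enumeration of the elements of $\Gamma$, $u_\Gamma=(g_1,\dots,g_1,\dots,g_r,\dots,g_r)$, where each $g_i$ is repeated $\mathrm{ord}(g_i)$ times. Definition of $H_{2,\Gamma}(G)$: let $F$ be the free group on symbols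 $\hat g$, $g\in G$, let $R=\ker(F\to G,\ \hat g\mapsto g)$, and let $R_\Gamma$ be the normal subgroup of $F$ normally generated by $[F,R]$ and all elements $\hat a\hat b\hat c^{-1}\hat b^{-1}$ with $a\in\Gamma$, $b\in G$, $c=b^{-1}ab$. Put $G_\Gamma=F/R_\Gamma$, with $\alpha:G_\Gamma\to G$ induced by $\hat g\mapsto g$. Then $H_{2,\Gamma}(G)=\ker(G_\Gamma\to G\times G_\Gamma^{ab})$, where the map has components $\alpha$ and the abelianisation. *)

(* Defs.v *)
From HB Require Import structures.
From mathcomp Require Import all_boot all_algebra fingroup perm.
From mathcomp Require Import generic_quotient zify.
From mathcomp Require Import boolp classical_sets cardinality.

Set Implicit Arguments.
Unset Strict Implicit.
Unset Printing Implicit Defensive.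

Local Open Scope group_scope.
Local Open Scope classical_set_scope.
Local Open Scope quotient_scope.

Section Subgroups.
Variable T : groupType.
Implicit Types (K S A B : set T) (x y : T).

Definition is_subgroup K : Prop := K 1 /\ (forall x y, K x -> K y -> K (x / y)).

Definition is_normal K : Prop :=
  is_subgroup K /\ (forall x y, K x -> K (x ^ y)).

Definition gen_subgroup S : set T :=
  [set x | forall K, is_subgroup K -> S `<=` K -> K x].

Definition comm_subgroup A B : set T :=
  gen_subgroup [set z | exists x y, [/\ A x, B y & z = [~ x, y]]].

Definition group_kernel (H : groupType) (f : T -> H) : set T := [set x | f x = 1].

Record normalSubgroup := NormalSubgroup {
  normal_set :> set T;
  normal_setP : is_normal normal_set }.

Lemma normal_closure_subproof S :
  is_normal [set x | forall K, is_normal K -> S `<=` K -> K x].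
Proof.
split; first split.
- by move=> K [[K1 _] _] _.
- by move=> x y Hx Hy K nK SK; case: (nK) => [[_ KF] _]; apply: KF;
    [exact: Hx|exact: Hy].
- by move=> x y Hx K nK SK; case: (nK) => _ KJ; apply: KJ; exact: Hx.
Qed.

Definition normal_closure S : normalSubgroup :=
  NormalSubgroup (normal_closure_subproof S).

Lemma derived_subproof : is_normal (comm_subgroup setT setT).
Proof.
split; first split.
- by move=> K [K1 _] _.
- move=> x y Hx Hy K sK SK; case: (sK) => _ KF.
  by apply: KF; [exact: Hx|exact: Hy].
- move=> x y Hx K sK SK; case: (sK) => K1 KF.
  apply: (Hx [set z | K (z ^ y)]).
    split=> [|a b Ka Kb] /=; first by rewrite conj1g.
    by rewrite conjMg conjVg; exact: KF.
  move=> _ [a [b [_ _ ->]]] /=; rewrite conjRg; apply: SK => /=.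
  by exists (a ^ y), (b ^ y).
Qed.

Definition derived_subgroup : normalSubgroup := NormalSubgroup derived_subproof.

End Subgroups.

Section Quotient.
Variables (T : groupType) (N : normalSubgroup T).

Definition quo_rel : rel T := fun x y => `[< normal_set N (x / y) >].

Let N1 : normal_set N 1. Proof. by case: (normal_setP N) => [[]]. Qed.
Let NF x y : normal_set N x -> normal_set N y -> normal_set N (x / y).
Proof. by case: (normal_setP N) => [[_ +] _]; apply. Qed.
Let NJ x y : normal_set N x -> normal_set N (x ^ y).
Proof. by case: (normal_setP N) => _; apply. Qed.
Let NV x : normal_set N x -> normal_set N x^-1.
Proof. by move=> Nx; rewrite -[x^-1]mul1g; exact: NF. Qed.
Let NM x y : normal_set N x -> normal_set N y -> normal_set N (x * y).
Proof. by move=> Nx Ny; rewrite -[y]invgK; apply: NF => //; exact: NV. Qed.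

Lemma quo_rel_refl : reflexive quo_rel.
Proof. by move=> x; apply/asboolP; rewrite mulgV. Qed.

Lemma quo_rel_sym : symmetric quo_rel.
Proof.
by move=> x y; apply/idP/idP => /asboolP H; apply/asboolP;
  rewrite -invgF; exact: NV.
Qed.

Lemma quo_rel_trans : transitive quo_rel.
Proof.
move=> y x z /asboolP H1 /asboolP H2; apply/asboolP.
by rewrite -(divgKA y x z^-1); exact: NM.
Qed.

Canonical quo_equiv := EquivRel quo_rel quo_rel_refl quo_rel_sym quo_rel_trans.

Definition quo := {eq_quot quo_equiv}.
HB.instance Definition _ := Choice.on quo.
HB.instance Definition _ := EqQuotient.on quo.

Lemma quo_eqP x y : reflect (normal_set N (x / y)) (\pi_quo x == \pi_quo y).
Proof. by rewrite eqmodE; exact: asboolP. Qed.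

Lemma quo_reprP x : normal_set N (x / repr (\pi_quo x)).
Proof. by apply/quo_eqP; rewrite reprK. Qed.

Definition quo_mul (a b : quo) : quo := \pi_quo (repr a * repr b).
Definition quo_one : quo := \pi_quo 1.
Definition quo_inv (a : quo) : quo := \pi_quo (repr a)^-1.

Lemma pi_mulE x y : quo_mul (\pi_quo x) (\pi_quo y) = \pi_quo (x * y).
Proof.
rewrite /quo_mul; apply/esym/eqP/quo_eqP.
move: (quo_reprP x) (quo_reprP y).
move: (repr (\pi_quo x)) (repr (\pi_quo y)) => x' y' Hx Hy.
have -> : x * y / (x' * y') = (x / x') * (y / y') ^ x'^-1.
  by rewrite /conjg !(invgK, invgM, mulgA) mulgVK.
by apply: NM => //; exact: NJ.
Qed.

Lemma pi_invE x : quo_inv (\pi_quo x) = \pi_quo x^-1.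
Proof.
rewrite /quo_inv; apply/esym/eqP/quo_eqP; rewrite invgK.
move: (quo_reprP x) => /NV; rewrite invgF => /(NJ x).
by rewrite /conjg mulgVK.
Qed.

Lemma quo_mulA : associative quo_mul.
Proof.
by elim/quotW=> a; elim/quotW=> b; elim/quotW=> c; rewrite (pi_mulE b c) (pi_mulE a b) !pi_mulE mulgA.
Qed.
Lemma quo_mul1 : left_id quo_one quo_mul.
Proof. by elim/quotW=> a; rewrite pi_mulE mul1g. Qed.
Lemma quo_mulg1 : right_id quo_one quo_mul.
Proof. by elim/quotW=> a; rewrite pi_mulE mulg1. Qed.
Lemma quo_mulV : left_inverse quo_one quo_inv quo_mul.
Proof. by elim/quotW=> a; rewrite pi_invE pi_mulE mulVg. Qed.
Lemma quo_mulgV : right_inverse quo_one quo_inv quo_mul.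
Proof. by elim/quotW=> a; rewrite pi_invE pi_mulE mulgV. Qed.

HB.instance Definition _ :=
  isGroup.Build quo quo_mulA quo_mul1 quo_mulg1 quo_mulV quo_mulgV.

Definition to_quo (x : T) : quo := \pi_quo x.

Lemma to_quo_morphism : {morph to_quo : x y / x * y}.
Proof. by move=> x y; apply/esym/pi_mulE. Qed.

Lemma to_quo_eq1 x : to_quo x = 1 <-> normal_set N x.
Proof.
by split=> [/eqP/quo_eqP|Nx]; [|apply/eqP/quo_eqP]; rewrite invg1 mulg1.
Qed.

(* The map induced by f on the quotient; meaningful when f is a morphism that
   is trivial on N, see quo_liftE. *)
Definition quo_lift (H : groupType) (f : T -> H) (a : quo) : H := f (repr a).

Lemma quo_liftE (H : groupType) (f : T -> H) :
    {morph f : x y / x * y} -> N `<=` group_kernel f ->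
  forall x, quo_lift f (to_quo x) = f x.
Proof.
move=> fM fN x; rewrite /quo_lift /to_quo.
have := fN _ (quo_reprP x); move: (repr _) => y /= E.
by rewrite -[x in RHS](mulgVK y) fM E mul1g.
Qed.

Lemma quo_lift_morphism (H : groupType) (f : T -> H) :
    {morph f : x y / x * y} -> N `<=` group_kernel f ->
  {morph quo_lift f : a b / a * b}.
Proof.
move=> fM fN; elim/quotW=> x; elim/quotW=> y; have E := quo_liftE fM fN.
rewrite -/(to_quo x) -/(to_quo y) -to_quo_morphism.
by rewrite (E x) (E y) -fM; exact: E.
Qed.

End Quotient.

Definition abelianisation (T : groupType) := quo (derived_subgroup T).
HB.instance Definition _ (T : groupType) := Group.on (abelianisation T).

Section Free.
Variable X : choiceType.

(* A word is a list of signed letters: (x, false) stands for x and (x, true)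
   for its inverse. *)
Definition word := seq (X * bool).
Definition flip (a : X * bool) := (a.1, ~~ a.2).

Inductive word_eq : word -> word -> Prop :=
| word_eq_refl u : word_eq u u
| word_eq_sym u v : word_eq u v -> word_eq v u
| word_eq_trans u v w : word_eq u v -> word_eq v w -> word_eq u w
| word_eq_cancel u a v : word_eq (u ++ [:: a; flip a] ++ v) (u ++ v).

Definition word_rel : rel word := fun u v => `[< word_eq u v >].

Lemma word_rel_refl : reflexive word_rel.
Proof. by move=> u; apply/asboolP; exact: word_eq_refl. Qed.
Lemma word_rel_sym : symmetric word_rel.
Proof.
by move=> u v; apply/idP/idP => /asboolP H; apply/asboolP; exact: word_eq_sym.
Qed.
Lemma word_rel_trans : transitive word_rel.
Proof.
move=> v u w /asboolP H1 /asboolP H2; apply/asboolP.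
exact: word_eq_trans H1 H2.
Qed.

Canonical word_equiv :=
  EquivRel word_rel word_rel_refl word_rel_sym word_rel_trans.

Definition free_group := {eq_quot word_equiv}.
HB.instance Definition _ := Choice.on free_group.
HB.instance Definition _ := EqQuotient.on free_group.

Lemma free_eqP u v : \pi_free_group u = \pi_free_group v <-> word_eq u v.
Proof.
by split=> [/eqP|H]; [|apply/eqP]; rewrite eqmodE => //; [move/asboolP|apply/asboolP].
Qed.

Lemma free_reprP u : word_eq u (repr (\pi_free_group u)).
Proof. by apply/free_eqP; rewrite reprK. Qed.

Lemma flipK : involutive flip.
Proof. by case=> x b; rewrite /flip negbK. Qed.

Definition word_inv (u : word) : word := rev (map flip u).

Lemma word_eq_cat u u' v v' :
  word_eq u u' -> word_eq v v' -> word_eq (u ++ v) (u' ++ v').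
Proof.
move=> Hu Hv; apply: (@word_eq_trans _ (u' ++ v)).
  elim: Hu => {u u'} [u|u u' _ IH|u u' w _ IH1 _ IH2|u a w].
  - exact: word_eq_refl.
  - exact: word_eq_sym.
  - exact: word_eq_trans IH1 IH2.
  - by rewrite -!catA; exact: word_eq_cancel.
elim: Hv => {v v'} [v|v v' _ IH|v v' w _ IH1 _ IH2|v a w].
- exact: word_eq_refl.
- exact: word_eq_sym.
- exact: word_eq_trans IH1 IH2.
- by rewrite !(catA u'); exact: word_eq_cancel.
Qed.

Lemma word_eq_inv u v : word_eq u v -> word_eq (word_inv u) (word_inv v).
Proof.
elim=> {u v} [u|u u' _ IH|u u' w _ IH1 _ IH2|u a w].
- exact: word_eq_refl.
- exact: word_eq_sym.
- exact: word_eq_trans IH1 IH2.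
- rewrite /word_inv !map_cat !rev_cat /= flipK.
  rewrite (_ : rev [:: flip a; a] = [:: a; flip a]) // -catA.
  exact: word_eq_cancel.
Qed.

Lemma word_invV u : word_eq (u ++ word_inv u) [::].
Proof.
elim/last_ind: u => [|u a IH]; first exact: word_eq_refl.
rewrite /word_inv map_rcons rev_rcons cat_rcons.
exact: word_eq_trans (word_eq_cancel _ _ _) IH.
Qed.

Lemma word_invK : involutive word_inv.
Proof.
by move=> u; rewrite /word_inv map_rev revK -map_comp map_id_in // => a _ /=; rewrite flipK.
Qed.

Definition free_mul (a b : free_group) : free_group := \pi_free_group (repr a ++ repr b).
Definition free_one : free_group := \pi_free_group [::].
Definition free_inv (a : free_group) : free_group := \pi_free_group (word_inv (repr a)).

Lemma pi_catE u v : free_mul (\pi_free_group u) (\pi_free_group v) = \pi_free_group (u ++ v).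
Proof. by apply/esym/free_eqP/word_eq_cat; exact: free_reprP. Qed.
Lemma pi_word_invE u : free_inv (\pi_free_group u) = \pi_free_group (word_inv u).
Proof. by apply/esym/free_eqP/word_eq_inv; exact: free_reprP. Qed.

Lemma free_mulA : associative free_mul.
Proof.
by elim/quotW=> a; elim/quotW=> b; elim/quotW=> c; rewrite (pi_catE b c) (pi_catE a b) !pi_catE catA.
Qed.
Lemma free_mul1 : left_id free_one free_mul.
Proof. by elim/quotW=> a; rewrite pi_catE. Qed.
Lemma free_mulg1 : right_id free_one free_mul.
Proof. by elim/quotW=> a; rewrite pi_catE cats0. Qed.
Lemma free_mulgV : right_inverse free_one free_inv free_mul.
Proof.
elim/quotW=> a; rewrite pi_word_invE pi_catE; apply/free_eqP.
exact: word_invV.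
Qed.
Lemma free_mulV : left_inverse free_one free_inv free_mul.
Proof.
elim/quotW=> a; rewrite pi_word_invE pi_catE; apply/free_eqP.
by rewrite -{2}[a]word_invK; exact: word_invV.
Qed.

HB.instance Definition _ :=
  isGroup.Build free_group free_mulA free_mul1 free_mulg1 free_mulV free_mulgV.

Definition free_gen (x : X) : free_group := \pi_free_group [:: (x, false)].

Section Lift.
Variables (H : groupType) (f : X -> H).

Definition letter_eval (a : X * bool) : H := if a.2 then (f a.1)^-1 else f a.1.
Definition word_eval (u : word) : H := \prod_(a <- u) letter_eval a.

Lemma word_eval_eq u v : word_eq u v -> word_eval u = word_eval v.
Proof.
elim=> {u v} // [u v w _ -> _ ->//|u [x b] v].
rewrite /word_eval !big_cat /= big_cons big_seq1 /letter_eval /=.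
by case: b; rewrite /= ?mulVg ?mulgV mul1g.
Qed.

Definition free_lift (a : free_group) : H := word_eval (repr a).

Lemma free_lift_pi u : free_lift (\pi_free_group u) = word_eval u.
Proof. by apply/esym/word_eval_eq; exact: free_reprP. Qed.

Lemma free_lift_gen x : free_lift (free_gen x) = f x.
Proof. by rewrite free_lift_pi /word_eval big_seq1. Qed.

Lemma free_lift_morphism : {morph free_lift : a b / a * b}.
Proof.
elim/quotW=> a; elim/quotW=> b; rewrite [_ * _]pi_catE !free_lift_pi.
by rewrite /word_eval big_cat.
Qed.

End Lift.
End Free.

(* The generators sigma_1, ..., sigma_(d-1) are indexed from 0. *)
Definition braid_relators (d : nat) : set (free_group 'I_d.-1) :=
  [set w | exists i j : 'I_d.-1,
     ((i.+1 < j)%N /\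
        w = (free_gen i * free_gen j) / (free_gen j * free_gen i)) \/
     ((j = i.+1 :> nat) /\
        w = (free_gen i * free_gen j * free_gen i) / (free_gen j * free_gen i * free_gen j))].

Definition braid (d : nat) := quo (normal_closure (@braid_relators d)).
HB.instance Definition _ d := Group.on (braid d).

Section Hurwitz.
Variables (gT : finGroupType) (d : nat).
Implicit Types (v : d.-tuple gT) (i j : 'I_d.-1).

Definition hurwitz_move i v : d.-tuple gT :=
  [tuple (if k == i :> nat then v`_i.+1
          else if k == i.+1 :> nat then (v`_i.+1)^-1 * v`_i * v`_i.+1
          else v`_k) | k < d].

Lemma hurwitz_move_nth i v k :
  (hurwitz_move i v)`_k =
    if k == i then v`_i.+1
    else if k == i.+1 then (v`_i.+1)^-1 * v`_i * v`_i.+1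
    else v`_k.
Proof.
have [kd|dk] := ltnP k d; first by rewrite -(tnth_nth 1 _ (Ordinal kd)) tnth_mktuple.
rewrite !(nth_default _ (_ : size _ <= k)%N) ?size_tuple //.
by have := ltn_ord i; do 2?case: eqP => //; lia.
Qed.

Lemma hurwitz_move_inj i : injective (hurwitz_move i).
Proof.
move=> v w E; apply: eq_from_tnth => k; rewrite !(tnth_nth 1).
have Ek n : (hurwitz_move i v)`_n = (hurwitz_move i w)`_n by rewrite E.
have E1 : v`_i.+1 = w`_i.+1 by have := Ek i; rewrite !hurwitz_move_nth eqxx.
have E0 : v`_i = w`_i.
  have := Ek i.+1; rewrite !hurwitz_move_nth eqxx E1.
  rewrite (_ : (i.+1 == i :> nat) = false); last by lia.
  by move/mulIg/mulgI.
have := Ek k; rewrite !hurwitz_move_nth.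
by case: eqP => [->//|_]; case: eqP => [->//|_].
Qed.

Definition hurwitz_gen i : {perm d.-tuple gT} := perm (@hurwitz_move_inj i).

(* Permutations compose from left to right, so this is a right action. *)
Definition hurwitz (b : braid d) : {perm d.-tuple gT} :=
  quo_lift (free_lift hurwitz_gen) b.

Lemma hurwitz_relators :
  @normal_closure (free_group 'I_d.-1) (@braid_relators d)
    `<=` group_kernel (free_lift hurwitz_gen).
Proof.
set f := free_lift _.
have fM : {morph f : x y / x * y} by exact: free_lift_morphism.
have f1 : f 1 = 1 by apply: (mulgI (f 1)); rewrite -fM !mulg1.
have fV x : f x^-1 = (f x)^-1.
  by apply: (mulgI (f x)); rewrite -fM !mulgV f1.
have E x y : f x = f y -> f (x / y) = 1 by move=> e; rewrite fM fV e mulgV.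
move=> x; apply.
  split; first split.
  - exact: f1.
  - by move=> a b; rewrite /group_kernel /= => Ha Hb; rewrite E // Ha.
  - by move=> a b; rewrite /group_kernel /= => Ha; rewrite /conjg !fM Ha mul1g fV mulVg.
move=> _ [i [j [[ij ->]|[ij ->]]]] /=; apply: E; rewrite !fM /f !free_lift_gen;
  apply/permP => v; rewrite !permM !permE;
  apply: eq_from_tnth => k; rewrite !(tnth_nth 1) !hurwitz_move_nth.
- move: (nth 1 v) (i : nat) (j : nat) (k : nat) ij => {v i j k} v i j k ij.
  by do ![case: eqP => ?; subst; rewrite ?eqxx //; try lia].
- rewrite ij; move: (nth 1 v) (i : nat) (k : nat) => {v i j k ij} v i k.
  do ![case: eqP => ?; subst; rewrite ?eqxx //; try lia];
    by rewrite ?invgM ?mulgA ?mulgVK ?mulgV ?mul1g ?mulgK.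
Qed.

Lemma hurwitzE i v : hurwitz (to_quo _ (free_gen i)) v = hurwitz_move i v.
Proof.
rewrite /hurwitz quo_liftE ?free_lift_gen ?permE //.
  exact: free_lift_morphism.
exact: hurwitz_relators.
Qed.

Lemma hurwitz_morphism : {morph hurwitz : a b / a * b}.
Proof.
exact: quo_lift_morphism (free_lift_morphism _) hurwitz_relators.
Qed.

End Hurwitz.
Arguments hurwitz {gT d} b.

(* The finite group G is the whole finGroupType gT.  A Hurwitz vector, i.e. an
   element of the disjoint union of the G^d, is a sequence over gT whose size
   is d. *)

Section HurwitzVectors.
Variable gT : finGroupType.
Implicit Types (v w : seq gT) (Gamma : {set gT}).

Definition braid_equiv v w : Prop :=
  exists b : braid (size v), tval (hurwitz b (in_tuple v)) = w.

Definition braid_class v : set (seq gT) := [set w | braid_equiv v w].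

Definition generates v : Prop := <<[set x in v]>>%g = [set: gT]%SET.

Definition conj_class := {C : {set gT} | C \in classes [set: gT]%SET}.

Definition nielsen v : {ffun conj_class -> int} :=
  [ffun C : conj_class => (count (fun x => x \in val C) v)%:Z]%R.

Definition u_vec Gamma : seq gT := flatten [seq nseq #[g] g | g <- enum Gamma].

Definition nontrivial_class_union Gamma : Prop :=
  exists K : {set {set gT}},
    [/\ {subset K <= classes [set: gT]%SET},
        [set 1]%SET \notin K
      & Gamma = finset.cover K].

Definition FG := free_group gT.
HB.instance Definition _ := Group.on FG.

Definition FG_to_G : FG -> gT := free_lift id.

(* FG, RG and RG_Gamma are F, R and R_Gamma. *)
Definition RG : set FG := group_kernel FG_to_G.

Definition RG_Gamma Gamma : normalSubgroup FG :=
  normal_closure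
    (comm_subgroup setT RG `|`
     [set w | exists a b : gT, a \in Gamma /\
        w = free_gen a * free_gen b * (free_gen (a ^ b))^-1 * (free_gen b)^-1]).

Definition G_Gamma Gamma := quo (RG_Gamma Gamma).
HB.instance Definition _ Gamma := Group.on (G_Gamma Gamma).

Definition alpha Gamma : G_Gamma Gamma -> gT := quo_lift FG_to_G.

Definition H2_Gamma Gamma : set (G_Gamma Gamma) :=
  group_kernel (fun x : G_Gamma Gamma =>
    (alpha x, to_quo (derived_subgroup (G_Gamma Gamma)) x)).

Lemma RG_Gamma_sub Gamma : RG_Gamma Gamma `<=` RG.
Proof.
have fM : {morph FG_to_G : x y / x * y} by exact: free_lift_morphism.
have f1 : FG_to_G 1 = 1 by apply: (mulgI (FG_to_G 1)); rewrite -fM !mulg1.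
have fV x : FG_to_G x^-1 = (FG_to_G x)^-1.
  by apply: (mulgI (FG_to_G x)); rewrite -fM !mulgV f1.
have nR : is_normal RG.
  split; first split.
  - exact: f1.
  - by move=> a b; rewrite /RG /group_kernel /= fM fV => -> ->; rewrite mulgV.
  - by move=> a b; rewrite /RG /group_kernel /= /conjg !fM fV => ->;
      rewrite mul1g mulVg.
move=> x; apply=> // y [|[a [b [_ ->]]]] /=.
  apply; first by case: nR.
  move=> _ [a [b [_ Rb ->]]]; move: Rb.
  by rewrite /RG /group_kernel /= /commg /conjg !fM !fV => ->; rewrite invg1 mulg1 mul1g mulVg.
rewrite /RG /group_kernel /= !fM !fV /FG_to_G !free_lift_gen.
by rewrite (conjgC a b) mulgK mulgV.
Qed.

Lemma alphaE Gamma x : alpha (to_quo (RG_Gamma Gamma) x) = FG_to_G x.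
Proof.
by rewrite /alpha quo_liftE //; [exact: free_lift_morphism|exact: RG_Gamma_sub].
Qed.

End HurwitzVectors.
Arguments H2_Gamma {gT} Gamma.

(* Main.v *)
(* Following Conway and Parker.  Modulo the braid action, words over [Gamma] form
   the monoid with relations [a b = b (a ^ b)], in which every word with trivial
   product is central.  If [v] generates [G] and contains more entries of a class
   than [u_vec Gamma] does, then some [g] in that class occurs more than [#[g]]
   times; splitting off [g ^ #[g]] leaves a generating word, and the central block
   [g ^ #[g]] may then be conjugated at will.  Hence right multiplication by any
   given word [z] is surjective between sets of generating classes of large
   Nielsen type.  A finiteness argument makes it injective in a stable range,
   where two generating words are therefore braid equivalent as soon as they
   agree after multiplication by a power of the central word [u_vec Gamma], i.e.
   as soon as they have the same type and the same image in the enveloping group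
   of the rack [Gamma] modulo [u_vec Gamma].  As this group is a central extension
   of [G], it receives a map from [G_Gamma], so that already the image in [G_Gamma]
   separates the classes of a given type.  These images fill a coset of the commutator
   subgroup of [G_Gamma], which is an extension of [[G, G]] by [H2_Gamma]. *)

Require Import Defs.
From HB Require Import structures.
From Stdlib Require Import Setoid Morphisms.
From mathcomp Require Import all_boot all_algebra fingroup perm.
From mathcomp Require Import generic_quotient zify.
From mathcomp Require Import boolp classical_sets functions cardinality.

Set Implicit Arguments.
Unset Strict Implicit.
Unset Printing Implicit Defensive.

(** * Words under single Hurwitz moves *)

Section HurwitzEq.
Local Open Scope group_scope.
Variable gT : finGroupType.
Implicit Types (v w s t x y : seq gT) (a b g h : gT) (P : pred gT).

(** A description by moves on words, free of lengths and braid groups; [braid_equivP] identifies it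
    with braid equivalence. It is a congruence for concatenation, so classes of words form a
    monoid. *)
Inductive hurwitz_eq : seq gT -> seq gT -> Prop :=
| hurwitz_eq_refl v : hurwitz_eq v v
| hurwitz_eq_sym v w : hurwitz_eq v w -> hurwitz_eq w v
| hurwitz_eq_trans v w s : hurwitz_eq v w -> hurwitz_eq w s -> hurwitz_eq v s
| hurwitz_eq_move x a b y :
    hurwitz_eq (x ++ a :: b :: y) (x ++ b :: a ^ b :: y).

Local Notation "v =~ w" := (hurwitz_eq v w) (at level 70).

#[local] Instance hurwitz_eq_equivalence : Equivalence hurwitz_eq.
Proof.
split; [exact: hurwitz_eq_refl|exact: hurwitz_eq_sym|exact: hurwitz_eq_trans].
Qed.

Lemma hurwitz_eq_catl x v w : v =~ w -> x ++ v =~ x ++ w.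
Proof.
elim=> {v w} [v|v w _ IH|v w s _ IH1 _ IH2|z a b y]; first reflexivity.
- by symmetry.
- by transitivity (x ++ w).
- by rewrite !catA; exact: hurwitz_eq_move.
Qed.

Lemma hurwitz_eq_catr y v w : v =~ w -> v ++ y =~ w ++ y.
Proof.
elim=> {v w} [v|v w _ IH|v w s _ IH1 _ IH2|x a b z]; first reflexivity.
- by symmetry.
- by transitivity (w ++ y).
- by rewrite -!catA; exact: hurwitz_eq_move.
Qed.

#[local] Instance cat_hurwitz_eq :
  Proper (hurwitz_eq ==> hurwitz_eq ==> hurwitz_eq) (@cat gT).
Proof.
move=> v v' vv' w w' ww'; transitivity (v' ++ w).
  exact: hurwitz_eq_catr.
exact: hurwitz_eq_catl.
Qed.

#[local] Instance cons_hurwitz_eq a : Proper (hurwitz_eq ==> hurwitz_eq) (cons a).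
Proof. by move=> v w; exact: (@hurwitz_eq_catl [:: a]). Qed.

Lemma hurwitz_eq_pass a s : a :: s =~ s ++ [:: a ^ (\prod_(b <- s) b)].
Proof.
elim: s a => [|b s IH] a /=; first by rewrite big_nil conjg1; reflexivity.
rewrite big_cons conjgM -IH; exact: (@hurwitz_eq_move [::]).
Qed.

Lemma hurwitz_eq_back s a : s ++ [:: a] =~ a :: [seq b ^ a | b <- s].
Proof.
elim: s => [|b s IH] /=; first reflexivity.
by rewrite IH; exact: (@hurwitz_eq_move [::]).
Qed.

(** Passing a letter rightwards through [s] conjugates it by the product of [s], here [1]. *)
Lemma hurwitz_eq_central s t : \prod_(b <- s) b = 1 -> t ++ s =~ s ++ t.
Proof.
move=> s1; elim: t => [|a t IH] /=; first by rewrite cats0; reflexivity.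
by rewrite IH -[a :: _]/((a :: s) ++ t) hurwitz_eq_pass s1 conjg1 -catA; reflexivity.
Qed.

Lemma prod_map_conj s h : \prod_(b <- [seq b ^ h | b <- s]) b = (\prod_(b <- s) b) ^ h.
Proof. by rewrite big_map conjg_prod. Qed.

(* As [s] is central, it can be moved next to an entry [a] of [w] on either
   side; the two resulting words differ by conjugating [s] by [a]. *)
Lemma hurwitz_eq_conj_block w s h :
  h \in <<[set x in w]>> -> \prod_(b <- s) b = 1 ->
  w ++ s =~ w ++ [seq b ^ h | b <- s].
Proof.
pose ok h := forall s, \prod_(b <- s) b = 1 -> w ++ s =~ w ++ [seq b ^ h | b <- s].
move=> hw; move: s; rewrite -/(ok h).
(* The good [h] contain [1] and are closed under products, hence form a subgroup of the finite
   group; it remains to treat the entries of [w]. *)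
suff gS : group_set [set h | `[< ok h >]].
  have /fintype.subsetP/(_ _ hw) : <<[set x in w]>> \subset group gS.
    rewrite gen_subG; apply/fintype.subsetP => a; rewrite !inE => aw s s1.
    case/splitPr: aw => x y.
    rewrite -!catA -[_ ++ s]/((a :: y) ++ s) (@hurwitz_eq_central s _ s1).
    rewrite -[s ++ _]/(s ++ [:: a] ++ y) (catA s) hurwitz_eq_back /=.
    by rewrite -(@hurwitz_eq_central _ y) ?prod_map_conj ?s1 ?conj1g //; reflexivity.
  by rewrite !inE => H; exact: H.
apply/group_setP; split=> [|a b].
  rewrite !inE => s _; rewrite (eq_map (@conjg1 _)) map_id.
  reflexivity.
rewrite !inE => Ha Hb s s1.
rewrite Ha // Hb; last by rewrite prod_map_conj s1 conj1g.
by rewrite -map_comp (eq_map (fun c => conjgM c a b)); reflexivity.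
Qed.

Lemma hurwitz_eq_count P v w :
  (forall a b, P (a ^ b) = P a) -> v =~ w -> count P v = count P w.
Proof.
move=> PJ; elim=> {v w} // [v w s _ -> _ -> //|x a b y].
by rewrite !count_cat /= PJ; lia.
Qed.

Lemma hurwitz_eq_size v w : v =~ w -> size v = size w.
Proof. by rewrite -!count_predT; exact: hurwitz_eq_count. Qed.

Lemma hurwitz_eq_gen v w : v =~ w -> <<[set x in v]>> = <<[set x in w]>> :> {set gT}.
Proof.
elim=> {v w} // [v w s _ -> _ -> //|x a b y].
apply/eqP; rewrite finset.eqEsubset !gen_subG.
have sub v w : {subset v <= w} -> [set x in v] \subset <<[set x in w]>>.
  by move=> vw; apply/fintype.subsetP => c; rewrite inE => /vw cw; rewrite mem_gen ?inE.
have mem w c : c \in w -> c \in <<[set x in w]>> by move=> cw; rewrite mem_gen ?inE.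
apply/andP; split; apply/fintype.subsetP => c; rewrite inE mem_cat !inE.
- case/or4P=> [cx|/eqP->|/eqP->|cy]; try by apply: mem; rewrite mem_cat !inE ?cx ?cy ?eqxx ?orbT.
  rewrite -(groupJr _ (mem _ b _)); last by rewrite mem_cat !inE eqxx ?orbT.
  by apply: mem; rewrite mem_cat !inE eqxx ?orbT.
- case/or4P=> [cx|/eqP->|/eqP->|cy]; try by apply: mem; rewrite mem_cat !inE ?cx ?cy ?eqxx ?orbT.
  by rewrite groupJ //; apply: mem; rewrite mem_cat !inE eqxx ?orbT.
Qed.

Lemma hurwitz_eq_generates v w : v =~ w -> generates v -> generates w.
Proof. by rewrite /generates => /hurwitz_eq_gen ->. Qed.

Lemma generates_sub v w : {subset v <= <<[set x in w]>>} -> generates v -> generates w.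
Proof.
rewrite /generates => vw Gv; apply/eqP; rewrite finset.eqEsubset finset.subsetT -Gv gen_subG.
by apply/fintype.subsetP => c; rewrite inE => /vw.
Qed.

(** Any [f] respecting [a b = b (a ^ b)] on letters in [P] yields an invariant of words. The
    predicate serves [G_Gamma], where this relation is imposed for [a] in [Gamma]. *)
Lemma hurwitz_eq_prod (H : groupType) (f : gT -> H) P v w :
    (forall a b, P (a ^ b) = P a) ->
    (forall a b, P a -> P b -> f a * f b = f b * f (a ^ b)) ->
  v =~ w -> all P v -> \prod_(a <- v) f a = \prod_(a <- w) f a.
Proof.
move=> PJ fJ; have allP v' w' : v' =~ w' -> all P v' = all P w'.
  by move=> E; rewrite !all_count (hurwitz_eq_size E) (hurwitz_eq_count PJ E).
elim=> {v w} // [v w E IH Pw|v w s E IH _ IH'|x a b y].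
- by rewrite IH // (allP _ _ E).
- by move=> Pv; rewrite IH // IH' // -(allP _ _ E).
- rewrite all_cat /= => /and4P[_ Pa Pb _].
  by rewrite !big_cat !big_cons /= (mulgA (f a)) fJ // !mulgA.
Qed.

Lemma hurwitz_eq_prod_id v w : v =~ w -> \prod_(a <- v) a = \prod_(a <- w) a.
Proof.
move=> E; apply: (@hurwitz_eq_prod gT id predT _ _ _ _ E) => //; last exact: all_predT.
by move=> a b _ _; exact: conjgC.
Qed.

(* Conjugation by [g] maps exactly [g] to [g], so moving one copy of [g] to the
   end neither creates nor destroys other copies. *)
Lemma hurwitz_eq_pull g v k :
  (k <= count_mem g v)%N -> exists w,
    v =~ w ++ nseq k g /\ count_mem g w = (count_mem g v - k)%N.
Proof.
elim: k v => [|k IH] v kv.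
  by exists v; rewrite cats0 subn0; split=> //; reflexivity.
have /splitPr vE : g \in v by rewrite -has_pred1 has_count; lia.
case: {v} vE kv => x y kv; pose v' := x ++ [seq b ^ g^-1 | b <- y].
have E : x ++ g :: y =~ v' ++ [:: g].
  rewrite /v' -catA hurwitz_eq_back -map_comp (eq_map (conjgKV g)) map_id.
  reflexivity.
have cE : count_mem g (x ++ g :: y) = (count_mem g v').+1.
  rewrite /v' !count_cat count_map /= eqxx add1n addnS; congr (_ + _).+1.
  apply: eq_count => b /=.
  by rewrite (can2_eq (conjgKV g) (conjgK g)) conjgE mulKg.
case: (IH v'); first by rewrite cE in kv.
move=> w [Ew cw]; exists w; split; last by rewrite cw cE subSS.
by rewrite E Ew -catA -(addn1 k) nseqD; reflexivity.
Qed.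

End HurwitzEq.

(** * Hurwitz moves and braid group orbits *)

Section BraidEquiv.
Local Open Scope group_scope.
Variable gT : finGroupType.
Implicit Types (v w s x y : seq gT) (a b : gT).

Lemma hurwitz_move_cat d (t : d.-tuple gT) (i : 'I_d.-1) x a b y :
    t = x ++ a :: b :: y :> seq gT -> i = size x :> nat ->
  hurwitz_move i t = x ++ b :: a ^ b :: y :> seq gT.
Proof.
move=> tE iE; apply: (@eq_from_nth _ 1) => [|k _].
  by rewrite size_tuple -(size_tuple t) tE !size_cat.
rewrite hurwitz_move_nth tE !nth_cat iE ltnn subnn ltnNge leqnSn /= subSn // subnn /=.
have [kx|xk] := ltnP k (size x).
  by rewrite !ltn_eqF // ltnW.
rewrite -(subnKC xk); case: (k - size x)%N => [|[|n]].
- by rewrite addn0 eqxx subnn.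
- by rewrite addn1 eqxx subSn // subnn gtn_eqF //= conjgE mulgA.
- by rewrite !gtn_eqF ?addKn //=; lia.
Qed.

Lemma hurwitz_eq_hurwitz d (b : braid d) (t : d.-tuple gT) :
  hurwitz_eq t (hurwitz b t).
Proof.
rewrite /hurwitz -[b]reprK; set f := repr b; rewrite -/(to_quo _ f).
rewrite (quo_liftE (@free_lift_morphism _ _ _) (@hurwitz_relators gT d)).
move: f; elim/quotW=> u; rewrite free_lift_pi.
elim: u t => [|[i e] u IH] t.
  by rewrite /word_eval big_nil perm1; exact: hurwitz_eq_refl.
rewrite /word_eval big_cons permM; apply: hurwitz_eq_trans (IH _).
rewrite /letter_eval /=.
have gen (s : d.-tuple gT) : hurwitz_eq s (hurwitz_gen gT i s).
  rewrite permE; have := ltn_ord i; set n := val i => lt_n.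
  have sE : s = take n s ++ s`_n :: s`_n.+1 :: drop n.+2 s :> seq gT.
    rewrite -drop_nth; last by rewrite size_tuple; lia.
    rewrite -drop_nth ?cat_take_drop //; rewrite size_tuple; lia.
  rewrite (@hurwitz_move_cat _ _ i _ _ _ _ sE); first by rewrite {1}sE; exact: hurwitz_eq_move.
  by rewrite size_takel // size_tuple; lia.
case: e => //.
(* An inverse generator is a move from its result back to [t], read backwards. *)
by apply: hurwitz_eq_sym; have := gen ((hurwitz_gen gT i)^-1 t); rewrite permKV.
Qed.

(** [braid_equiv] indexes its braid group by the length of the word; substituting that length for
    [d] avoids a transport between braid groups. *)
Lemma braid_equiv_hurwitz d (b : braid d) (t : d.-tuple gT) :
  braid_equiv t (hurwitz b t).
Proof.
case: t => s sd; have ds := eqP sd; subst d; exists b.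
by congr (tval (hurwitz b _)); exact: val_inj.
Qed.

Lemma braid_equiv_tuple d (t : d.-tuple gT) w :
  braid_equiv t w -> exists b : braid d, tval (hurwitz b t) = w.
Proof.
case: t => s sd; have ds := eqP sd; subst d => -[b <-]; exists b.
by congr (tval (hurwitz b _)); exact: val_inj.
Qed.

Lemma braid_equivP v w : braid_equiv v w <-> hurwitz_eq v w.
Proof.
split=> [[b <-]|]; first exact: (hurwitz_eq_hurwitz b (in_tuple v)).
have hM d := @hurwitz_morphism gT d.
have h1 d : hurwitz (1 : braid d) = 1 :> {perm d.-tuple gT}.
  by apply: (mulgI (hurwitz 1)); rewrite -hM !mulg1.
elim=> {v w} [v|v w _ [b <-]|v w s _ [b <-] _ /braid_equiv_tuple[c <-]|x a b y].
- by exists 1; rewrite h1 perm1.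
- have := braid_equiv_hurwitz b^-1 (hurwitz b (in_tuple v)).
  by rewrite -permM -hM mulgV h1 perm1.
- by exists (b * c); rewrite hM permM.
- have ix : (size x < (size (x ++ a :: b :: y)).-1)%N by rewrite size_cat /=; lia.
  exists (to_quo _ (free_gen (Ordinal ix))); rewrite hurwitzE.
  exact: hurwitz_move_cat.
Qed.

Lemma braid_class_eq v w : braid_class v = braid_class w <-> hurwitz_eq v w.
Proof.
split=> [E|vw].
  apply/braid_equivP; suff : braid_class v w by [].
  by rewrite E; apply/braid_equivP; exact: hurwitz_eq_refl.
apply/predeqP => s; split=> /braid_equivP H; apply/braid_equivP.
  exact: hurwitz_eq_trans (hurwitz_eq_sym vw) H.
exact: hurwitz_eq_trans vw H.
Qed.

End BraidEquiv.

(** * Nielsen types counted class by class *)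

Section NielsenCount.
Local Open Scope group_scope.
Variable gT : finGroupType.
Implicit Types (v w s t x y z : seq gT) (a b g h : gT) (C : conj_class gT).

Definition ncount C v : nat := count (fun a => a \in val C) v.

Lemma nielsen_eqP v w : nielsen v = nielsen w <-> forall C, ncount C v = ncount C w.
Proof.
split=> [E C|E]; last by apply/ffunP => C; rewrite !ffunE; congr Posz; exact: E.
by have /ffunP/(_ C) := E; rewrite !ffunE => -[].
Qed.

Lemma ncount_cat C v w : ncount C (v ++ w) = (ncount C v + ncount C w)%N.
Proof. exact: count_cat. Qed.

Definition cls a : conj_class gT := exist _ (a ^: [set: gT]%SET) (mem_classes (finset.in_setT a)).

Lemma conj_classJ C a b : (a ^ b \in val C) = (a \in val C).
Proof.
case: C => C /= /imsetP[x _ ->].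
by rewrite ![_ \in x ^: _]class_sym (class_eqP (memJ_class a (finset.in_setT b))).
Qed.

Lemma mem_cls a : a \in val (cls a).
Proof. exact: class_refl. Qed.

Lemma conj_class_conj C a b : a \in val C -> b \in val C -> exists h, b = a ^ h.
Proof.
case: C => C /= /imsetP[x _ ->] /class_eqP <- /imsetP[h _ ->].
by exists h.
Qed.

Lemma mem_conj_class C a b : b \in val (cls a) -> (b \in val C) = (a \in val C).
Proof. by case/imsetP => h _ ->; rewrite conj_classJ. Qed.

Lemma hurwitz_eq_ncount C v w : hurwitz_eq v w -> ncount C v = ncount C w.
Proof. exact: hurwitz_eq_count (conj_classJ C). Qed.

(** Each letter lies in exactly one class; hence words of equal type have equal length. *)
Lemma size_ncount v : size v = (\sum_C ncount C v)%N.
Proof.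
elim: v => [|a v IH]; first by rewrite big1.
rewrite /= -add1n big_split /= -IH; congr (_ + _)%N.
rewrite (bigD1 (cls a)) //= mem_cls big1 // => C Ca.
case: (boolP (a \in val C)) => // aC; case/eqP: Ca; apply: val_inj => /=.
by case: C aC => C /= /imsetP[x _ ->] /class_eqP.
Qed.

Lemma count_sum_mem (P : pred gT) v : count P v = (\sum_(g | P g) count_mem g v)%N.
Proof.
elim: v => [|a v IH]; first by rewrite big1.
rewrite /= big_split /= -IH; congr (_ + _)%N.
case: (boolP (P a)) => Pa.
  by rewrite (bigD1 a) //= eqxx big1 // => b /andP[_ /negbTE]; rewrite eq_sym => ->.
by rewrite big1 // => b Pb; case: eqP => // E; rewrite E Pb in Pa.
Qed.

(** For each letter of [t] a conjugate is deleted from [v]; the rest is [z], so a word over [Gamma]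
    leaves a word over [Gamma]. *)
Lemma ncount_split t v :
  (forall C, (ncount C t <= ncount C v)%N) ->
  exists z, {subset z <= v} /\ forall C, ncount C v = (ncount C t + ncount C z)%N.
Proof.
elim: t v => [|a t IH] v tv; first by exists v; split=> // C; rewrite add0n.
have /hasP[b bv ba] : has (fun b => b \in val (cls a)) v.
  by rewrite has_count; have := tv (cls a); rewrite /ncount /= class_refl; lia.
case/splitPr: bv tv => x y tv.
have bC C := mem_conj_class C ba.
have E C : ncount C (x ++ b :: y) = ((a \in val C) + ncount C (x ++ y))%N.
  by rewrite !ncount_cat /ncount /= bC addnCA.
case: (IH (x ++ y)) => [C|z [zxy zE]].
  by have := tv C; rewrite E /ncount /= leq_add2l.
exists z; split=> [c /zxy|C]; first by rewrite !mem_cat inE => /orP[->|->]; rewrite ?orbT.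
by rewrite E zE addnA.
Qed.

End NielsenCount.

(** * Splitting off words and cancelling in the stable range *)

Section Stability.
Local Open Scope group_scope.
Variables (gT : finGroupType) (Gamma : {set gT}).
Hypothesis GammaJ : forall a b : gT, (a ^ b \in Gamma) = (a \in Gamma).
Implicit Types (v w s t x y z : seq gT) (a b g h : gT) (C : conj_class gT).

Local Notation "v =~ w" := (hurwitz_eq v w) (at level 70).
Local Notation u := (u_vec Gamma).
Local Notation all_Gamma := (all (mem Gamma)).

Lemma prod_u_vec : \prod_(a <- u) a = 1.
Proof.
rewrite big_flatten big_map big1_seq // => g _.
by rewrite big_nseq iter_mulg_1 expg_order.
Qed.

Lemma count_u_vec g : count_mem g u = ((g \in Gamma) * #[g])%N.
Proof.
rewrite count_flatten -map_comp sumnE big_map big_enum /=.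
rewrite (eq_bigr (fun a => (a == g) * #[g])%N); last first.
  by move=> a _; rewrite count_nseq /=; case: eqP => [->|].
case: (boolP (g \in Gamma)) => gG.
  by rewrite (bigD1 g) //= eqxx big1 ?addn0 // => b /andP[_ /negbTE->].
by rewrite big1 // => b bG; case: eqP => // E; rewrite -E bG in gG.
Qed.

Lemma mem_u_vec g : (g \in u) = (g \in Gamma).
Proof. by rewrite -has_pred1 has_count count_u_vec muln_gt0 order_gt0 andbT lt0b. Qed.

Lemma all_u_vec : all_Gamma u.
Proof. by apply/allP => g; rewrite mem_u_vec. Qed.

Lemma hurwitz_eq_all v w : v =~ w -> all_Gamma v = all_Gamma w.
Proof.
move=> E; rewrite !all_count (hurwitz_eq_size E); congr (_ == _).
by apply: hurwitz_eq_count E => a b; exact: GammaJ.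
Qed.

Definition upow k : seq gT := flatten (nseq k u).

Lemma upowD k l : upow (k + l) = upow k ++ upow l.
Proof. by rewrite /upow nseqD flatten_cat. Qed.

Lemma upowS k : upow k.+1 = u ++ upow k.
Proof. by []. Qed.

Lemma prod_upow k : \prod_(a <- upow k) a = 1.
Proof. by elim: k => [|k IH]; rewrite ?big_nil // upowS big_cat /= prod_u_vec IH mulg1. Qed.

Lemma all_upow k : all_Gamma (upow k).
Proof. by elim: k => // k IH; rewrite upowS all_cat all_u_vec. Qed.

Lemma ncount_upow C k : ncount C (upow k) = (k * ncount C u)%N.
Proof. by elim: k => // k IH; rewrite upowS ncount_cat IH mulSn. Qed.

(** Equal lengths give equal exponents unless [u] is empty, in which case all its powers are
    empty. *)
Lemma upow_size_eq k l : size (upow k) = size (upow l) -> upow k = upow l.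
Proof.
have sE n : size (upow n) = (n * size u)%N.
  by elim: n => // n IH; rewrite upowS size_cat IH mulSn.
move=> E; have := E; rewrite (sE k) (sE l) => /eqP; rewrite eqn_mul2r => /orP[/eqP u0|/eqP->//].
have nil n : upow n = [::] by apply: size0nil; rewrite sE u0 muln0.
by rewrite (nil k) (nil l).
Qed.

Lemma upow_central k v : v ++ upow k =~ upow k ++ v.
Proof. exact/hurwitz_eq_central/prod_upow. Qed.

(* Some conjugate [g] of [a] occurs more than [#[g]] times, so [g ^ #[g]] can be
   split off without losing generation, and then replaced by [a ^ #[a]]. *)
Lemma peel1 v a :
    a \in Gamma -> generates v -> (ncount (cls a) u < ncount (cls a) v)%N ->
  exists2 w, generates w & v =~ w ++ [:: a].
Proof.
move=> aG Gv lt_uv.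
have [g ga lt_g] : exists2 g, g \in val (cls a) & (count_mem g u < count_mem g v)%N.
  apply: contrapT => H; move: lt_uv; rewrite ltnNge => /negP; apply.
  rewrite /ncount (count_sum_mem _ v) (count_sum_mem _ u); apply: leq_sum => g ga.
  by rewrite leqNgt; apply/negP => lt_g; apply: H; exists g.
have [h aE] := conj_class_conj ga (mem_cls a).
have gG : g \in Gamma by rewrite -(GammaJ _ h) -aE.
rewrite count_u_vec gG mul1n in lt_g.
have [w [vw cw]] := hurwitz_eq_pull (ltnW lt_g).
have gw : g \in w by rewrite -has_pred1 has_count cw subn_gt0.
have Gw : generates w.
  apply: generates_sub (hurwitz_eq_generates vw Gv) => b.
  rewrite mem_cat mem_nseq => /orP[bw|/andP[_ /eqP->]]; by rewrite mem_gen ?inE.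
exists (w ++ nseq #[g].-1 a).
  by apply: generates_sub Gw => b bw; rewrite mem_gen // inE mem_cat bw.
apply: (hurwitz_eq_trans vw).
apply: hurwitz_eq_trans (_ : hurwitz_eq _ (w ++ [seq b ^ h | b <- nseq #[g] g])) _.
  apply: hurwitz_eq_conj_block; first by rewrite Gw inE.
  by rewrite big_nseq iter_mulg_1 expg_order.
rewrite map_nseq -aE -catA -{1}(prednK (order_gt0 g)) -addn1 nseqD.
exact: hurwitz_eq_refl.
Qed.

(** Letters of [z] are split off from the right; each step lowers both counts alike, so the surplus
    over [u] required by [peel1] persists. *)
Lemma peel v z :
    all_Gamma z -> generates v ->
    (forall C, (ncount C u + ncount C z <= ncount C v)%N) ->
  exists2 w, generates w & v =~ w ++ z.
Proof.
elim/last_ind: z v => [|z a IH] v.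
  by move=> _ Gv _; exists v; rewrite ?cats0 //; exact: hurwitz_eq_refl.
rewrite all_rcons => /andP[aG zG] Gv le_v.
have cE C : ncount C (rcons z a) = (ncount C z + (a \in val C))%N.
  by rewrite -cats1 ncount_cat /ncount /= addn0.
case: (@peel1 v a) => // [|w Gw vw].
  by have := le_v (cls a); rewrite cE mem_cls; lia.
case: (IH w) => // [C|w' Gw' ww'].
  have := le_v C; rewrite cE (hurwitz_eq_ncount C vw) ncount_cat /ncount /=; lia.
exists w' => //; rewrite -cats1 catA; apply: hurwitz_eq_trans vw _.
exact: hurwitz_eq_catr.
Qed.

(** Take one [a] out of [u]. The rest [x] has product [a^-1], which commutes with [a], so [a] passes
    through [x] unchanged. *)
Lemma u_complement1 a : a \in Gamma ->
  exists x, [/\ all_Gamma x, x ++ [:: a] =~ u & a :: x =~ u].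
Proof.
move=> aG; have [|x [E _]] := @hurwitz_eq_pull _ a u 1.
  by rewrite count_u_vec aG mul1n order_gt0.
exists x; split; [|exact: hurwitz_eq_sym|].
  by have := all_u_vec; rewrite (hurwitz_eq_all E) all_cat => /andP[].
apply: hurwitz_eq_trans (hurwitz_eq_sym E).
have : \prod_(b <- x ++ [:: a]) b = 1.
  by rewrite -[RHS]prod_u_vec; exact/esym/hurwitz_eq_prod_id.
rewrite big_cat /= big_seq1 => /eqP; rewrite mulg_eq1 => /eqP xE.
by have := hurwitz_eq_pass a x; rewrite xE conjgE mulgV mulg1 invgK.
Qed.

(** Words over [Gamma] are invertible modulo powers of the central word [u]: concatenate the
    complements of the letters in reverse order. *)
Lemma u_complement s : all_Gamma s -> exists x,
  [/\ all_Gamma x, x ++ s =~ upow (size s) & s ++ x =~ upow (size s)].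
Proof.
elim: s => [|a s IH] /=; first by exists [::]; split=> //; exact: hurwitz_eq_refl.
case/andP => aG /IH[x [xG xs sx]]; have [y [yG ya ay]] := u_complement1 aG.
have central := @hurwitz_eq_central _ u _ prod_u_vec.
exists (x ++ y); split; first by rewrite all_cat xG.
- rewrite -catA -[y ++ _]/(y ++ [:: a] ++ s) (catA y).
  apply: hurwitz_eq_trans (hurwitz_eq_catl _ (hurwitz_eq_catr _ ya)) _.
  rewrite catA; apply: hurwitz_eq_trans (hurwitz_eq_catr _ (central x)) _.
  by rewrite -catA upowS; exact: hurwitz_eq_catl.
- rewrite catA -[a :: _]/([:: a] ++ _).
  apply: hurwitz_eq_trans (hurwitz_eq_catl [:: a] (hurwitz_eq_catr y sx)) _.
  rewrite catA; apply: hurwitz_eq_trans (hurwitz_eq_catr _ (upow_central _ _)) _.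
  rewrite -catA; apply: hurwitz_eq_trans (hurwitz_eq_catl _ ay) _.
  exact: central.
Qed.

(* The stabilised relation on words of a fixed length is witnessed by a single
   power of [u], there being finitely many pairs of such words. *)
Lemma uniform_stabilisation : exists K, forall w w',
    size w = size u -> size w' = size u ->
    (exists k, w ++ upow k =~ w' ++ upow k) ->
  w ++ upow K =~ w' ++ upow K.
Proof.
pose T := (size u).-tuple gT.
have [p|K HK] := @choice (T * T)%type nat (fun p k =>
    (exists k, p.1 ++ upow k =~ p.2 ++ upow k) -> p.1 ++ upow k =~ p.2 ++ upow k).
  have [[k Hk]|H] := EM (exists k, p.1 ++ upow k =~ p.2 ++ upow k).
    by exists k.
  by exists 0%N.
exists (\max_p K p)%N => w w' /eqP sw /eqP sw' H.
pose p : T * T := (Tuple sw, Tuple sw').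
rewrite -(subnKC (leq_bigmax p : K p <= _)%N) upowD !catA.
exact/hurwitz_eq_catr/(HK p).
Qed.

(** Both words are cut back to words [w], [w'] of length [size u] followed by a common [y].
    Completing [y] to a power of [u] carries the stable equality over to [w] and [w'], where [HK]
    applies; the factor [upow K] of [y] then gives [v =~ v']. *)
Lemma stable_cancel K v v' :
    (forall w w', size w = size u -> size w' = size u ->
      (exists k, w ++ upow k =~ w' ++ upow k) -> w ++ upow K =~ w' ++ upow K) ->
    all_Gamma v -> generates v -> generates v' ->
    (forall C, ncount C v = ncount C v') ->
    (forall C, K.+1 * ncount C u <= ncount C v)%N ->
    (exists k, v ++ upow k =~ v' ++ upow k) ->
  v =~ v'.
Proof.
move=> HK vG Gv Gv' vv' leKv [k vk].
(* Of the [K.+1] copies of [u], [K] go into [y]; the last is the surplus that [peel] requires. *)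
have [C|z [zv zE]] := @ncount_split _ (upow K.+1) v; first by rewrite ncount_upow.
have zG : all_Gamma z by apply/allP => a /zv av; exact: (allP vG).
pose y := upow K ++ z.
have yG : all_Gamma y by rewrite all_cat all_upow.
have vE C : ncount C v = (ncount C u + ncount C y)%N.
  by rewrite zE upowS !ncount_cat addnA.
have [|w Gw vw] := peel yG Gv; first by move=> C; rewrite vE.
have [|w' Gw' vw'] := peel yG Gv'; first by move=> C; rewrite -vv' vE.
have sw x x' : (forall C, ncount C x = ncount C v) -> x =~ x' ++ y -> size x' = size u.
  move=> xv xE; rewrite !size_ncount; apply: eq_bigr => C _.
  by have := xv C; rewrite (hurwitz_eq_ncount C xE) ncount_cat vE => /addIn.
have [x [xG _ yx]] := u_complement yG.
suff ww' : w ++ upow K =~ w' ++ upow K.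
  apply: hurwitz_eq_trans vw _; apply: hurwitz_eq_trans (hurwitz_eq_sym vw').
  by rewrite /y !catA; exact: hurwitz_eq_catr.
(* In the exponent, [size y] pays for completing [y] and [k] for the given stable equality. *)
apply: HK; [exact: sw vw|exact: sw vw'|exists (size y + k)%N].
have E q q' : q =~ q' ++ y -> q' ++ upow (size y + k) =~ q ++ upow k ++ x.
  move=> qq'; apply: hurwitz_eq_trans _ (hurwitz_eq_sym (hurwitz_eq_catr _ qq')).
  rewrite -catA; apply: hurwitz_eq_catl; rewrite upowD.
  apply: hurwitz_eq_trans (hurwitz_eq_sym (hurwitz_eq_catr _ yx)) _.
  by rewrite -catA; exact/hurwitz_eq_catl/upow_central.
apply: hurwitz_eq_trans (E _ _ vw) _; apply: hurwitz_eq_trans (hurwitz_eq_sym (E _ _ vw')).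
by rewrite !catA; exact: hurwitz_eq_catr.
Qed.

End Stability.

(** * Elementary facts on group morphisms *)

Section Morphisms.
Local Open Scope group_scope.
Variables (T H : groupType) (f : T -> H).
Hypothesis fM : {morph f : x y / x * y}.

Lemma morph_one : f 1 = 1.
Proof. by apply: (mulgI (f 1)); rewrite -fM !mulg1. Qed.

Lemma morph_inv x : f x^-1 = (f x)^-1.
Proof. by apply: (mulgI (f x)); rewrite -fM !mulgV morph_one. Qed.

Lemma morph_comm x y : f [~ x, y] = [~ f x, f y].
Proof. by rewrite !commgEl !conjgE !fM !morph_inv. Qed.

Lemma morph_prod (I : Type) (r : seq I) (F : I -> T) :
  f (\prod_(i <- r) F i) = \prod_(i <- r) f (F i).
Proof. by elim: r => [|i r IH]; rewrite ?big_nil ?morph_one // !big_cons fM IH. Qed.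

Lemma group_kernel_normal : is_normal (group_kernel f).
Proof.
split; first split; rewrite /group_kernel /=.
- exact: morph_one.
- by move=> x y fx fy; rewrite fM morph_inv fx fy mulgV.
- by move=> x y fx; rewrite conjgE !fM morph_inv fx mul1g mulVg.
Qed.

End Morphisms.

Definition conj_stable (gT : finGroupType) (Gamma : {set gT}) :=
  forall a b : gT, ((a ^ b)%g \in Gamma) = (a \in Gamma).

(** * The group of stabilised words and its map from the free group *)

Section StableGroup.
Local Open Scope group_scope.
Local Open Scope quotient_scope.
Variables (gT : finGroupType) (Gamma : {set gT}).
Implicit Types (v w s t x y z : seq gT) (a b g h : gT).

Local Notation "v =~ w" := (hurwitz_eq v w) (at level 70).
Local Notation upow := (upow Gamma).
Local Notation all_Gamma := (all (mem Gamma)).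
Local Notation filt := (filter (mem Gamma)).

Lemma filt_id s : all_Gamma s -> filt s = s.
Proof. by move/all_filterP. Qed.

(* Letters outside [Gamma] are read as the identity, which avoids a subtype of
   words over [Gamma]. *)
Definition stab_rel : rel (seq gT) :=
  fun s t => `[< exists k l, filt s ++ upow k =~ filt t ++ upow l >].

Lemma stab_rel_refl : reflexive stab_rel.
Proof. by move=> s; apply/asboolP; exists 0%N, 0%N; exact: hurwitz_eq_refl. Qed.

Lemma stab_rel_sym : symmetric stab_rel.
Proof.
by move=> s t; apply/idP/idP => /asboolP[k [l E]]; apply/asboolP;
  exists l, k; exact: hurwitz_eq_sym.
Qed.

Lemma stab_rel_trans : transitive stab_rel.
Proof.
move=> t s r /asboolP[k [l E]] /asboolP[m [n E']]; apply/asboolP.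
exists (k + m)%N, (n + l)%N; rewrite !upowD !catA.
apply: hurwitz_eq_trans (hurwitz_eq_catr _ E) _.
apply: hurwitz_eq_trans (hurwitz_eq_catr _ E').
by rewrite -!catA -!upowD addnC; exact: hurwitz_eq_refl.
Qed.

Canonical stab_equiv := EquivRel stab_rel stab_rel_refl stab_rel_sym stab_rel_trans.

(* The enveloping group of the rack [Gamma], modulo the central element
   represented by [u_vec Gamma]. *)
Definition stab_group of conj_stable Gamma := {eq_quot stab_equiv}.

Variable GammaJ : conj_stable Gamma.
Local Notation Q := (stab_group GammaJ).
HB.instance Definition _ := Choice.on Q.
HB.instance Definition _ := EqQuotient.on Q.

Lemma stab_eqP s t :
  \pi_Q s = \pi_Q t <-> exists k l, filt s ++ upow k =~ filt t ++ upow l.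
Proof.
by split=> [/eqP|H]; [|apply/eqP]; rewrite eqmodE => //; [move/asboolP|apply/asboolP].
Qed.

Definition stab_mul (p q : Q) : Q := \pi_Q (repr p ++ repr q).
Definition stab_one : Q := \pi_Q [::].

Lemma stab_mulE s t : stab_mul (\pi_Q s) (\pi_Q t) = \pi_Q (s ++ t).
Proof.
rewrite /stab_mul; apply/stab_eqP; rewrite !filter_cat.
have /stab_eqP[k [l E]] := reprK (\pi_Q s); have /stab_eqP[m [n E']] := reprK (\pi_Q t).
have split_upow x y i j : (x ++ y) ++ upow (i + j) =~ (x ++ upow i) ++ (y ++ upow j).
  rewrite upowD -!catA; apply: hurwitz_eq_catl; rewrite !catA.
  exact/hurwitz_eq_catr/upow_central.
exists (k + m)%N, (l + n)%N; apply: hurwitz_eq_trans (split_upow _ _ _ _) _.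
apply: hurwitz_eq_trans (hurwitz_eq_sym (split_upow _ _ _ _)).
exact: hurwitz_eq_trans (hurwitz_eq_catl _ E') (hurwitz_eq_catr _ E).
Qed.

Lemma stab_complement s : exists x, all_Gamma x /\
  (x ++ filt s =~ upow (size (filt s)) /\ filt s ++ x =~ upow (size (filt s))).
Proof. by have [x [xG E E']] := u_complement GammaJ (filter_all (mem Gamma) s); exists x. Qed.

Definition stab_inv (p : Q) : Q := \pi_Q (projT1 (cid (stab_complement (repr p)))).

Lemma pi_upow k : \pi_Q (upow k) = stab_one.
Proof.
apply/stab_eqP; exists 0%N, k; rewrite filt_id ?all_upow //= cats0.
exact: hurwitz_eq_refl.
Qed.

Lemma pi_hurwitz s t : filt s =~ filt t -> \pi_Q s = \pi_Q t.
Proof. by move=> E; apply/stab_eqP; exists 0%N, 0%N; rewrite !cats0. Qed.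

Lemma stab_mulA : associative stab_mul.
Proof.
by elim/quotW=> a; elim/quotW=> b; elim/quotW=> c;
  rewrite (stab_mulE b c) (stab_mulE a b) !stab_mulE catA.
Qed.
Lemma stab_mul1 : left_id stab_one stab_mul.
Proof. by elim/quotW=> a; rewrite stab_mulE. Qed.
Lemma stab_mulg1 : right_id stab_one stab_mul.
Proof. by elim/quotW=> a; rewrite stab_mulE cats0. Qed.
Lemma stab_mulV : left_inverse stab_one stab_inv stab_mul.
Proof.
move=> p; rewrite /stab_inv; case: cid => x /= [xG [E _]].
rewrite -[p in LHS]reprK stab_mulE -(pi_upow (size (filt (repr p)))).
by apply: pi_hurwitz; rewrite filter_cat filt_id // (filt_id (all_upow _ _)).
Qed.
Lemma stab_mulgV : right_inverse stab_one stab_inv stab_mul.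
Proof.
move=> p; rewrite /stab_inv; case: cid => x /= [xG [_ E]].
rewrite -[p in LHS]reprK stab_mulE -(pi_upow (size (filt (repr p)))).
by apply: pi_hurwitz; rewrite filter_cat (filt_id xG) (filt_id (all_upow _ _)).
Qed.

HB.instance Definition _ :=
  isGroup.Build Q stab_mulA stab_mul1 stab_mulg1 stab_mulV stab_mulgV.

Lemma pi_cat s t : \pi_Q (s ++ t) = \pi_Q s * \pi_Q t.
Proof. exact/esym/stab_mulE. Qed.

Lemma pi_prod s : \prod_(a <- s) \pi_Q [:: a] = \pi_Q s.
Proof. by elim: s => [|a s IH]; rewrite ?big_nil // big_cons IH -pi_cat. Qed.

Lemma pi_central s p :
  all_Gamma s -> \prod_(a <- s) a = 1 -> p * \pi_Q s = \pi_Q s * p.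
Proof.
move=> sG s1; rewrite -[p]reprK -!pi_cat; apply: pi_hurwitz.
by rewrite !filter_cat (filt_id sG); exact: hurwitz_eq_central.
Qed.

Hypothesis genU : generates (u_vec Gamma).

(** As [G] is finite, generators suffice without their inverses. *)
Lemma gen_word g : exists s, all_Gamma s /\ \prod_(a <- s) a = g.
Proof.
have : g \in <<[set x in u_vec Gamma]>> by rewrite genU inE.
case/gen_prodgP => n [c cG ->]; exists [seq c i | i <- index_enum 'I_n].
split; last by rewrite big_map.
by apply/allP => _ /mapP[i _ ->] /=; have := cG i; rewrite inE mem_u_vec.
Qed.

(** A section of the product map on words. It fixes the letters of [Gamma], so that relators between
    them become Hurwitz moves. *)
Lemma section_subproof : exists f : gT -> seq gT, forall g,
  [/\ all_Gamma (f g), \prod_(a <- f g) a = g & g \in Gamma -> f g = [:: g]].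
Proof.
have [g|f Hf] := @choice gT (seq gT) (fun g s =>
  [/\ all_Gamma s, \prod_(a <- s) a = g & g \in Gamma -> s = [:: g]]); last by exists f.
case: (boolP (g \in Gamma)) => gG; last by have [s [sG sE]] := gen_word g; exists s.
by exists [:: g]; split=> //=; rewrite ?gG ?big_seq1.
Qed.

Definition gword : gT -> seq gT := projT1 (cid section_subproof).

Lemma gwordP g : [/\ all_Gamma (gword g), \prod_(a <- gword g) a = g
  & g \in Gamma -> gword g = [:: g]].
Proof. by rewrite /gword; case: cid. Qed.

Definition to_stab : FG gT -> Q := free_lift (fun g => \pi_Q (gword g)).

Lemma to_stabM : {morph to_stab : x y / x * y}.
Proof. exact: free_lift_morphism. Qed.

Lemma to_stab_gen g : to_stab (free_gen g) = \pi_Q (gword g).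
Proof. exact: free_lift_gen. Qed.

(** Inverse letters are traded for complements, so the image of [x] is a word over [Gamma]; its
    product then detects membership of [x] in [R]. *)
Lemma to_stabP (x : FG gT) : exists s,
  [/\ all_Gamma s, to_stab x = \pi_Q s & \prod_(a <- s) a = FG_to_G x].
Proof.
rewrite /to_stab /FG_to_G; elim/quotW: x => u; rewrite !free_lift_pi.
elim: u => [|[g e] u [s [sG sE sp]]].
  by exists [::]; rewrite /word_eval !big_nil.
rewrite /word_eval !big_cons -/(word_eval _ u) -/(word_eval _ u) sE -sp.
have [gG gp _] := gwordP g; rewrite /letter_eval /=; case: e => /=; last first.
  by exists (gword g ++ s); rewrite all_cat gG sG pi_cat big_cat /= gp.
have [x [xG xg _]] := u_complement GammaJ gG.
exists (x ++ s); rewrite all_cat xG sG pi_cat big_cat /=; split=> //.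
  congr (_ * _); apply: (mulIg (\pi_Q (gword g))).
    rewrite mulVg -pi_cat -[LHS](pi_upow (size (gword g))); apply: pi_hurwitz.
    rewrite (filt_id (all_upow _ _)) filt_id ?all_cat ?xG //.
    exact: hurwitz_eq_sym.
  congr (_ * _); apply: (mulIg g).
  by rewrite mulVg -{1}gp -big_cat (hurwitz_eq_prod_id xg) prod_upow.
Qed.

(** Commutators with [R] die because elements of [R] map to words of trivial product, which are
    central; the other relators die because [a] passes through the word of [b] and becomes
    [a ^ b]. *)
Lemma to_stab_RG_Gamma (r : FG gT) : normal_set (RG_Gamma Gamma) r -> to_stab r = 1.
Proof.
move=> Hr; have nK := group_kernel_normal to_stabM.
apply: (Hr _ nK) => {r Hr} r [Hr|[a [b [aG ->]]]].
  apply: (Hr _ (proj1 nK)) => {r Hr} _ [x [y [_ Ry ->]]].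
  have [s [sG sE sy]] := to_stabP y.
  rewrite /group_kernel /= (morph_comm to_stabM); apply/eqP/commgP; rewrite sE.
  by apply: pi_central; rewrite // sy.
rewrite /group_kernel /= !to_stabM !(morph_inv to_stabM) !to_stab_gen.
have [_ _ ->] := gwordP a => //; have [_ _ ->] := gwordP (a ^ b); last by rewrite GammaJ.
have [bG bE _] := gwordP b; move: (gword b) bG bE => t tG tE.
suff -> : \pi_Q [:: a] * \pi_Q t = \pi_Q t * \pi_Q [:: a ^ b] by rewrite mulgK mulgV.
rewrite -!pi_cat; apply: pi_hurwitz.
rewrite !filter_cat (filt_id tG) /= GammaJ aG -tE.
exact: hurwitz_eq_pass.
Qed.

Definition geval v : G_Gamma Gamma :=
  \prod_(a <- v) to_quo (RG_Gamma Gamma) (free_gen a).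

Lemma geval_cat v w : geval (v ++ w) = geval v * geval w.
Proof. exact: big_cat. Qed.

(** By [to_stab_RG_Gamma], equal images in [G_Gamma] give equal images under [to_stab], which sends
    a word over [Gamma] to its own class. *)
Lemma geval_inj v w : all_Gamma v -> all_Gamma w -> geval v = geval w ->
  exists k l, v ++ upow k =~ w ++ upow l.
Proof.
move=> vG wG; rewrite /geval -!(morph_prod (@to_quo_morphism _ _)).
move=> /eqP/quo_eqP/to_stab_RG_Gamma; rewrite to_stabM (morph_inv to_stabM) => /divg1_eq.
rewrite !(morph_prod to_stabM).
have E s : all_Gamma s -> \prod_(a <- s) to_stab (free_gen a) = \pi_Q s.
  move=> /allP sG; rewrite -pi_prod; apply: eq_big_seq => a /sG aG.
  by rewrite to_stab_gen; have [_ _ ->] := gwordP a.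
by rewrite !E // => /stab_eqP; rewrite !filt_id.
Qed.

End StableGroup.

(** * Evaluation of words in the central extension [G_Gamma] *)

Section Evaluation.
Local Open Scope group_scope.
Variables (gT : finGroupType) (Gamma : {set gT}).
Hypothesis GammaJ : conj_stable Gamma.
Hypothesis genU : generates (u_vec Gamma).

Local Notation "v =~ w" := (hurwitz_eq v w) (at level 70).
Local Notation u := (u_vec Gamma).
Local Notation upow := (upow Gamma).
Local Notation all_Gamma := (all (mem Gamma)).
Local Notation GG := (G_Gamma Gamma).
Local Notation D := (normal_set (derived_subgroup GG)).
Local Notation toD := (to_quo (derived_subgroup GG)).
Local Notation ev := (@geval gT Gamma).
Local Notation hat := (fun a => to_quo (RG_Gamma Gamma) (free_gen a)).

Implicit Types (v w s t : seq gT) (a b g : gT) (x y z : GG).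

Lemma hat_conj a b : a \in Gamma -> hat a * hat b = hat b * hat (a ^ b).
Proof.
move=> aG; rewrite -!to_quo_morphism; apply/eqP/quo_eqP => K nK RK.
by rewrite invgM mulgA; apply: RK; right; exists a, b.
Qed.

Lemma geval_hurwitz v w : v =~ w -> all_Gamma v -> ev v = ev w.
Proof.
apply: hurwitz_eq_prod => [a b|a b aG _]; first exact: GammaJ.
exact: hat_conj.
Qed.

Lemma alphaM : {morph (@alpha gT Gamma) : x y / x * y}.
Proof. exact: quo_lift_morphism (@free_lift_morphism _ _ _) (@RG_Gamma_sub _ _). Qed.

Lemma alpha_hat a : alpha (hat a) = a.
Proof. by rewrite alphaE /FG_to_G free_lift_gen. Qed.

Lemma alpha_geval v : alpha (ev v) = \prod_(a <- v) a.
Proof. by rewrite (morph_prod alphaM); apply: eq_bigr => a _; exact: alpha_hat. Qed.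

(** A representative of [z] in [F] lies in [R], and [[F, R]] is trivial in [G_Gamma]. *)
Lemma alpha_central z : alpha z = 1 -> forall y, commute y z.
Proof.
elim/quotW: z => f; rewrite -/(to_quo _ f) alphaE => Rf; elim/quotW=> g.
rewrite -/(to_quo _ g); apply/commgP/eqP; rewrite -(morph_comm (@to_quo_morphism _ _)).
apply/to_quo_eq1 => K nK RK; apply: RK; left => K' _; apply.
by exists g, f.
Qed.

Lemma geval_upow_central k y : commute y (ev (upow k)).
Proof. by apply: alpha_central; rewrite alpha_geval prod_upow. Qed.

Lemma comm_mul_central x y z : (forall z', commute z' z) -> [~ x * z, y] = [~ x, y].
Proof.
move=> cz; rewrite !commgEl invgM conjMg.
have -> : z ^ y = z by rewrite conjgE -cz mulKg.
by rewrite -mulgA (mulgA x^-1) cz mulKg.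
Qed.

(** With [comm_mul_central], this reduces commutators in [G_Gamma] to commutators of words over
    [Gamma], which have a Nielsen type. *)
Lemma geval_mod_central x : exists s z,
  [/\ all_Gamma s, forall y, commute y z & x = ev s * z].
Proof.
have [s [sG sx]] := gen_word genU (alpha x).
exists s, ((ev s)^-1 * x); split=> //; last by rewrite mulVKg.
apply: alpha_central; rewrite alphaM (morph_inv alphaM) alpha_geval sx.
exact: mulVg.
Qed.

Lemma geval_complement s : all_Gamma s -> exists t,
  [/\ all_Gamma t, ev t = (ev s)^-1 * ev (upow (size s)) &
      forall C, (ncount C t + ncount C s = size s * ncount C u)%N].
Proof.
move=> sG; have [t [tG ts _]] := u_complement GammaJ sG.
exists t; split=> // [|C].
  rewrite geval_upow_central -(geval_hurwitz ts); last by rewrite all_cat tG.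
  by rewrite geval_cat mulgK.
by rewrite -ncount_upow -(hurwitz_eq_ncount C ts) ncount_cat.
Qed.

(* Having a numerator and a denominator of the same Nielsen type stands in for
   a degree map on [G_Gamma]. *)
Lemma derived_fraction x : D x -> exists k s,
  [/\ all_Gamma s, x * ev (upow k) = ev s &
      forall C, ncount C s = (k * ncount C u)%N].
Proof.
pose K := [set x | exists k s, [/\ all_Gamma s, x * ev (upow k) = ev s &
      forall C, ncount C s = (k * ncount C u)%N]]%classic.
move=> Dx; apply: (Dx K) => {x Dx}.
  split=> [|x y [k [s [sG xs sC]]] [l [t [tG yt tC]]]].
    by exists 0%N, [::]; rewrite mul1g.
  have [t' [t'G t't t'C]] := geval_complement tG.
  (* The word [upow l ++ t'] evaluates to [y^-1 * ev (upow (size t))]. *)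
  exists (k + size t)%N, (s ++ upow l ++ t'); split.
  - by rewrite !all_cat sG all_upow t'G.
  - rewrite !geval_cat t't -xs -yt invgM upowD geval_cat -[in RHS](mulgA _ y^-1) mulVKg.
    by rewrite !mulgA -(mulgA x) (geval_upow_central k y^-1) !mulgA.
  - by move=> C; have := t'C C; rewrite !ncount_cat ncount_upow sC tC; lia.
move=> _ [x [y [_ _ ->]]].
have [s [z [sG cz ->]]] := geval_mod_central x.
have [t [z' [tG cz' ->]]] := geval_mod_central y.
(* Inverting a commutator swaps its entries, so the central factor of the second entry drops out
   like that of the first. *)
rewrite comm_mul_central // -invgR comm_mul_central // invgR.
have [s' [s'G s's s'C]] := geval_complement sG.
have [t' [t'G t't t'C]] := geval_complement tG.
(* This word evaluates to the commutator of [ev s] and [ev t] times two central powers of [u]. *)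
exists (size s + size t)%N, (s' ++ t' ++ s ++ t); split.
- by rewrite !all_cat s'G sG t'G tG.
- rewrite !geval_cat s's t't upowD geval_cat commgEl conjgE.
  have cU := geval_upow_central (size s); have cV := geval_upow_central (size t).
  move: (ev (upow (size s))) (ev (upow (size t))) cU cV => U V cU cV.
  rewrite !mulgA [in RHS]cU [in RHS]cV !mulgA.
  by rewrite [in LHS]cV [in LHS]cU !mulgA.
- by move=> C; have := s'C C; have := t'C C; rewrite !ncount_cat; lia.
Qed.

Lemma toD_commute x y : commute (toD x) (toD y).
Proof.
apply/commgP/eqP; rewrite -(morph_comm (@to_quo_morphism _ _)).
by apply/to_quo_eq1 => K _; apply; exists x, y.
Qed.

(** By [hat_conj], conjugate letters of [Gamma] agree in the abelianisation, so the letters of [v]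
    and [w] cancel in pairs. *)
Lemma geval_ncount v w :
    all_Gamma v -> all_Gamma w -> (forall C, ncount C v = ncount C w) ->
  D (ev v / ev w).
Proof.
move=> vG wG vw; apply/quo_eqP/eqP; rewrite -!/(toD _).
elim: v w vG wG vw => [|a s IH] w.
  move=> _ _ /(fun H C => esym (H C)) w0; suff -> : w = [::] by [].
  by apply: size0nil; rewrite size_ncount big1.
case/andP=> aG sG wG sw.
have /hasP[b bw ba] : has (fun b => b \in val (cls a)) w.
  by rewrite has_count -[count _ _]/(ncount _ w) -sw /ncount /= class_refl.
have bC C := mem_conj_class C ba; have [h bE] := conj_class_conj (mem_cls a) ba.
case/splitPr: bw wG sw => x y; rewrite !all_cat /= => /and3P[xG bG yG] sw.
have ab : toD (hat b) = toD (hat a).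
  apply: (mulgI (toD (hat h))); rewrite bE -to_quo_morphism -hat_conj // to_quo_morphism.
  exact: toD_commute.
rewrite -cat1s !geval_cat -[b :: y]cat1s geval_cat /geval !big_seq1 -!/(ev _).
rewrite !to_quo_morphism ab mulgA (toD_commute (ev x)) -mulgA; congr (_ * _).
rewrite -to_quo_morphism -geval_cat; apply: IH; rewrite ?all_cat ?xG //.
by move=> C; have := sw C; rewrite !ncount_cat /ncount /= bC addnCA => /addnI.
Qed.

(** Write [x] as [ev s / ev (upow k)]; splitting [upow k] off from [s ++ v0] leaves the required
    [v]. *)
Lemma geval_surj v0 x :
    all_Gamma v0 -> generates v0 -> (forall C, ncount C u <= ncount C v0)%N -> D x ->
  exists v, [/\ all_Gamma v, generates v, forall C, ncount C v = ncount C v0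
    & ev v = x * ev v0].
Proof.
move=> v0G Gv0 le_u /derived_fraction[k [s [sG xs sC]]].
have svG : all_Gamma (s ++ v0) by rewrite all_cat sG.
have [||C|v Gv sv] := @peel _ _ GammaJ (s ++ v0) (upow k).
- exact: all_upow.
- by apply: generates_sub Gv0 => b bv; rewrite mem_gen // inE mem_cat bv orbT.
- by rewrite ncount_upow ncount_cat sC addnC leq_add2l.
exists v; split=> // [|C|].
- by move: svG; rewrite (hurwitz_eq_all GammaJ sv) all_cat => /andP[].
- have := hurwitz_eq_ncount C sv; rewrite !ncount_cat sC ncount_upow addnC.
  by move/addIn.
- apply: (mulIg (ev (upow k))); rewrite -geval_cat -(geval_hurwitz sv) // geval_cat.
  by rewrite -xs -!mulgA geval_upow_central.
Qed.

End Evaluation.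

(** * Counting the commutator subgroup of [G_Gamma] *)

Lemma set_bij_card (T U : Type) (A : set T) (B : set U) (f : T -> U) :
  set_bij A B f -> (A #= B)%card.
Proof. by move=> fbij; exact: pcard_eq fbij. Qed.

Section Derived.
Local Open Scope group_scope.
Local Open Scope classical_set_scope.
Variables (gT : finGroupType) (Gamma : {set gT}).
Local Notation GG := (G_Gamma Gamma).
Local Notation D := (normal_set (derived_subgroup GG)).
Local Notation derG := [~: [set: gT]%SET, [set: gT]%SET].

Lemma derivedM x y : D x -> D y -> D (x * y).
Proof.
have [[D1 DF] _] := derived_subproof GG; move=> Dx Dy.
by rewrite -[y]invgK; apply: (DF) => //; rewrite -[y^-1]mul1g; apply: DF.
Qed.

Lemma derivedV x : D x -> D x^-1.
Proof.
by have [[D1 DF] _] := derived_subproof GG; move=> Dx; rewrite -[x^-1]mul1g; apply: DF.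
Qed.

Lemma alpha_derived (x : GG) : D x -> alpha x \in derG.
Proof.
move=> Dx; apply: (Dx [set x | alpha x \in derG]).
  split=> [|y z /= yG zG]; first by rewrite /= (morph_one (@alphaM _ _)).
  by rewrite alphaM (morph_inv (@alphaM _ _)) groupM ?groupV.
move=> _ [y [z [_ _ ->]]] /=; rewrite (morph_comm (@alphaM _ _)).
by apply: mem_commg; rewrite inE.
Qed.

Lemma alpha_derived_surj g : g \in derG -> exists x : GG, D x /\ alpha x = g.
Proof.
have gS : group_set [set g | `[< exists x : GG, D x /\ alpha x = g >]]%SET.
  apply/group_setP; split=> [|a b]; rewrite !inE.
    exists 1; split; last exact: (morph_one (@alphaM _ _)).
    by have [[]] := derived_subproof GG.
  move=> [x [Dx <-]] [y [Dy <-]]; exists (x * y).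
  by split; [exact: derivedM|exact: alphaM].
have /fintype.subsetP sub : derG \subset group gS.
  rewrite gen_subG; apply/fintype.subsetP => _ /imset2P[a b _ _ ->].
  pose hat a : GG := to_quo (RG_Gamma Gamma) (free_gen a).
  rewrite !inE; exists [~ hat a, hat b].
  split; first by move=> K _; apply; exists (hat a), (hat b).
  by rewrite (morph_comm (@alphaM _ _)) !alpha_hat.
by move/sub; rewrite !inE.
Qed.

Lemma H2_GammaP (x : GG) : H2_Gamma Gamma x <-> alpha x = 1 /\ D x.
Proof.
split=> [[ax Dx]|[ax Dx]]; first by split=> //; apply/to_quo_eq1.
by apply: congr2 => //; apply/to_quo_eq1.
Qed.

(** [H2_Gamma Gamma] is the kernel of [alpha] on the commutator subgroup. With a section [sec] of
    [alpha] over [[G, G]], the bijection is [(h, g)] to [h * sec g]. *)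
Lemma card_derived :
  (H2_Gamma Gamma `*` [set g : gT | g \in derG] #= D)%card.
Proof.
have [g|sec secP] := @choice gT GG (fun g x => g \in derG -> D x /\ alpha x = g).
  case: (boolP (g \in derG)) => [/alpha_derived_surj[x xP]|_]; first by exists x.
  by exists 1.
apply: (@set_bij_card _ _ _ _ (fun p => p.1 * sec p.2)); split.
- by move=> [h g] [/H2_GammaP[_ Dh] /secP[Dg _]]; exact: derivedM.
- move=> [h g] [h' g'] /set_mem[/= /H2_GammaP[h1 _] /secP[_ ag]].
  move=> /set_mem[/= /H2_GammaP[h'1 _] /secP[_ ag']] E.
  have gg' : g = g'.
    by rewrite -ag -ag' -[LHS]mul1g -[RHS]mul1g -{1}h1 -h'1 -!alphaM E.
  by move: E; rewrite gg' => /mulIg ->.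
- move=> x Dx; have [Ds as_] := secP _ (alpha_derived Dx).
  exists (x / sec (alpha x), alpha x) => /=; last by rewrite mulgVK.
  split=> /=; last exact: alpha_derived.
  apply/H2_GammaP; split; last by apply: derivedM => //; exact: derivedV.
  by rewrite alphaM (morph_inv (@alphaM _ _)) as_ mulgV.
Qed.

End Derived.

(** * Braid classes of a given type against the commutator subgroup *)

Section BraidClasses.
Local Open Scope group_scope.
Local Open Scope classical_set_scope.
Variables (gT : finGroupType) (Gamma : {set gT}).
Hypothesis GammaJ : conj_stable Gamma.
Hypothesis genU : generates (u_vec Gamma).
Local Notation all_Gamma := (all (mem Gamma)).
Local Notation upow := (upow Gamma).

Lemma nielsen_all v w : nielsen v = nielsen w -> all_Gamma w -> all_Gamma v.
Proof.
move/nielsen_eqP => vw /allP wG; apply/allP => a av.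
have /hasP[b /wG bG /imsetP[h _ bE]] : has (fun b => b \in val (cls a)) w.
  rewrite has_count -[count _ _]/(ncount _ w) -vw -has_count.
  by apply/hasP; exists a; rewrite ?mem_cls.
by move: bG; rewrite /= bE GammaJ.
Qed.

(** The class of [v] corresponds to [geval Gamma v / geval Gamma v0]. All values occur by
    [geval_surj]; [geval_inj] and [stable_cancel] separate the classes. The bijection is built in
    the other direction, from chosen words [f x]. *)
Lemma card_braid_classes K v1 :
    (forall w w', size w = size (u_vec Gamma) -> size w' = size (u_vec Gamma) ->
      (exists k, hurwitz_eq (w ++ upow k) (w' ++ upow k)) ->
      hurwitz_eq (w ++ upow K) (w' ++ upow K)) ->
    all_Gamma v1 ->
    (forall C, K.+1 * ncount C (u_vec Gamma) <= ncount C v1)%N ->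
  ([set braid_class v | v in [set v | nielsen v = nielsen v1 /\ generates v]]
     #= normal_set (derived_subgroup (G_Gamma Gamma)))%card.
Proof.
move=> HK v1G le_v1.
have le_u C : (ncount C (u_vec Gamma) <= ncount C v1)%N.
  by apply: leq_trans (le_v1 C); rewrite leq_pmull.
have [z [zv1 zC]] := ncount_split le_u.
(* [v1] may fail to generate; this word of the same type contains [u_vec Gamma] and does
   generate. *)
pose v0 := u_vec Gamma ++ z.
have v0C C : ncount C v0 = ncount C v1 by rewrite ncount_cat zC.
have v0G : all_Gamma v0.
  by rewrite all_cat all_u_vec; apply/allP => a /zv1; exact: (allP v1G).
have Gv0 : generates v0.
  by apply: generates_sub genU => b bu; rewrite mem_gen // inE mem_cat bu.
have geval_hurwitz_eq v w : nielsen v = nielsen v1 -> nielsen w = nielsen v1 ->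
    generates v -> generates w ->
  geval Gamma v = geval Gamma w <-> hurwitz_eq v w.
  move=> vE wE Gv Gw; have vG := nielsen_all vE v1G; have wG := nielsen_all wE v1G.
  split=> [E|/geval_hurwitz]; last by apply.
  have vw C : ncount C v = ncount C w by apply: (proj1 (nielsen_eqP _ _)); rewrite vE.
  apply: (stable_cancel GammaJ HK) => // [C|].
    by rewrite (proj1 (nielsen_eqP _ _) vE).
  (* The two exponents may differ, but equal lengths of [v] and [w] force the two powers of
     [u_vec Gamma] to coincide. *)
  have [k [l kl]] := geval_inj GammaJ genU vG wG E; exists k.
  suff kl_eq : upow k = upow l by rewrite {2}kl_eq.
  have svw : size v = size w by rewrite !size_ncount; apply: eq_bigr => C _.
  by have := hurwitz_eq_size kl; rewrite !size_cat svw => /addnI/upow_size_eq.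
have [x|f fP] := @choice (G_Gamma Gamma) (seq gT) (fun x v =>
    normal_set (derived_subgroup (G_Gamma Gamma)) x ->
    [/\ nielsen v = nielsen v1, generates v & geval Gamma v = x * geval Gamma v0]).
  have [Dx|nDx] := pselect (normal_set (derived_subgroup (G_Gamma Gamma)) x); last first.
    by exists [::].
  have [|v [vG Gv vC vx]] := geval_surj GammaJ genU v0G Gv0 _ Dx; first by move=> C; rewrite v0C.
  by exists v; split=> //; apply/nielsen_eqP => C; rewrite vC v0C.
rewrite card_eq_sym; apply: (@set_bij_card _ _ _ _ (fun x => braid_class (f x))); split.
- by move=> x /fP[fE Gf _]; exists (f x).
- move=> x y /set_mem/fP[fx Gx xE] /set_mem/fP[fy Gy yE] /braid_class_eq.
  by move/geval_hurwitz_eq => /(_ fx fy Gx Gy); rewrite xE yE => /mulIg.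
- move=> _ [w [wE Gw] <-].
  have wC C : ncount C w = ncount C v0 by rewrite v0C; exact: (proj1 (nielsen_eqP _ _) wE).
  have Dx := geval_ncount (nielsen_all wE v1G) v0G wC.
  exists (geval Gamma w / geval Gamma v0) => //.
  have [fE Gf fx] := fP _ Dx.
  by apply/braid_class_eq/geval_hurwitz_eq => //; rewrite fx mulgVK.
Qed.

End BraidClasses.

(** * The uniform constant and the conclusion *)

Lemma class_union_conj_stable (gT : finGroupType) (Gamma : {set gT}) :
  nontrivial_class_union Gamma -> conj_stable Gamma.
Proof.
case=> K [Kcl _ ->].
have sub a b : a \in finset.cover K -> (a ^ b)%g \in finset.cover K.
  case/finset.bigcupP => C CK aC; apply/finset.bigcupP; exists C => //.
  pose C' : conj_class gT := exist _ C (Kcl _ CK).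
  by rewrite -[C]/(val C') conj_classJ.
by move=> a b; apply/idP/idP => [/(sub _ b^-1%g)|/sub //]; rewrite conjgK.
Qed.

Local Open Scope ring_scope.
Local Open Scope classical_set_scope.
Local Open Scope card_scope.

Theorem theorem6p11 (gT : finGroupType) :
  exists m : int,
    forall Gamma : {set gT},
      nontrivial_class_union Gamma ->
      generates (u_vec Gamma) ->
      forall nu0 : {ffun conj_class gT -> int},
        (exists v : seq gT, {subset v <= Gamma} /\ nielsen v = nu0) ->
        (forall C : conj_class gT, m * nielsen (u_vec Gamma) C <= nu0 C) ->
        [set braid_class v | v in [set v : seq gT |
           nielsen v = nu0 /\ generates v]]
        #= H2_Gamma Gamma `*`
           [set g : gT | g \in [~: [set: gT]%SET, [set: gT]%SET]%g].
Proof.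
have [K HK] := choice (@uniform_stabilisation gT).
(* The maximum over all subsets makes the constant depend on [G] alone; the successor is the extra
   copy of [u_vec Gamma] asked for by [stable_cancel]. *)
exists (\max_Gamma (K Gamma).+1)%N%:Z => Gamma /class_union_conj_stable GammaJ genU.
move=> _ [v1 [v1G <-]] le_v1.
apply: (card_eq_trans (card_braid_classes GammaJ genU (HK Gamma) _ _)).
- exact/allP.
- move=> C; have := le_v1 C; rewrite !ffunE -PoszM lez_nat; apply: leq_trans.
  by rewrite leq_mul2r (leq_bigmax Gamma) orbT.
- by rewrite card_eq_sym; exact: card_derived.
Qed.
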